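(* Let $G$ be a finite nonabelian nested $p$-group with chain of centers $G=X_0>X_1>\dots>X_n\ge1$, and put $d_i=|G:X_i|^{1/2}$ for $i=0,\dots,n$. If $G'\le X_n$, then $|[X_{i-1},G]:[X_i,G]|\le d_i$ for all $i=1,\dots,n$; in particular $|G'|\le d_1d_2\cdots d_n$.
   Context: For $\chi\in\mathrm{Irr}(G)$, $Z(\chi)=\{g\in G: |\chi(g)|=\chi(1)\}$. $G$ is nested if for all $\chi,\psi\in\mathrm{Irr}(G)$ either $Z(\chi)\le Z(\psi)$ or $Z(\psi)\le Z(\chi)$; then the distinct subgroups $Z(\chi)$ form a chain $G=X_0>X_1>\dots>X_n\ge1$, the chain of centers (one has $X_n=Z(G)$, and under the hypothesis the indices $|G:X_i|$ are perfect squares). *)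

(* Defs.v *)
From HB Require Import structures.
From mathcomp Require Import all_boot all_order all_algebra all_fingroup all_solvable all_field all_character.
Set Implicit Arguments. Unset Strict Implicit. Unset Printing Implicit Defensive.
Import Order.TTheory GRing.Theory Num.Theory.
Local Open Scope ring_scope.

Definition nested (gT : finGroupType) (G : {group gT}) : bool :=
  [forall i : Iirr G, forall j : Iirr G,
     ('Z('chi[G]_i)%CF \subset 'Z('chi[G]_j)%CF) || ('Z('chi[G]_j)%CF \subset 'Z('chi[G]_i)%CF)].

Definition char_centers (gT : finGroupType) (G : {group gT}) : {set {set gT}} :=
  [set ('Z('chi[G]_i)%CF : {set gT}) | i : Iirr G].

Definition chain_of_centers (gT : finGroupType) (G : {group gT}) (n : nat)
    (X : nat -> {group gT}) : Prop :=
  [/\ X 0 = G,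
      (forall i, (i < n)%N -> X i.+1 \proper X i) &
      [set (X i : {set gT}) | i : 'I_n.+1] = char_centers G].

(* Main.v *)
(* Since G' <= X_n = Z(G), commutators are bilinear. Put N = [X_i,G] and
   M = [X_(i-1),G]. If N <= T <= G' does not contain M, some irreducible chi has
   T but not M in its kernel; its center is a member of the chain that does not
   contain X_(i-1), so it lies in X_i, and any x with [x,G] <= T is in X_i. Hence
   each nontrivial character of M/N gives a nondegenerate alternating form on
   G/X_i. If |M/N| = p^k, this yields over F_p a k-dimensional space of
   alternating r x r matrices whose nonzero members are all invertible, with
   p^r <= |G : X_i|. The Pfaffian is then a form of degree r/2 in k variables
   with only the trivial zero, so 2k <= r by Chevalley-Warning. The finiteness of
   the field is essential: over the reals the quaternions give k = 3, r = 4. *)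

Require Import Defs.
From HB Require Import structures.
From mathcomp Require Import all_boot all_order all_algebra all_fingroup all_solvable all_field all_character.
Import Order.TTheory GRing.Theory Num.Theory.

Set Implicit Arguments. Unset Strict Implicit. Unset Printing Implicit Defensive.
Local Open Scope ring_scope.

(** * Alternating matrices over prime fields *)

(** For [e > 0], ['X^e - 1] has at most [e < p - 1] roots, so some nonzero [x] has [x ^+ e != 1];
    multiplication by [x] permutes the terms and scales the sum by [x ^+ e]. For [e = 0] the
    convention [0 ^+ 0 = 1] gives [p] ones. *)
Lemma sum_expr_Fp p e : prime p -> (e < p.-1)%N -> \sum_(x : 'F_p) x ^+ e = 0.
Proof.
move=> p_pr; case: e => [|e] lt_e.
  under eq_bigr do rewrite expr0.
  by rewrite sumr_const card_Fp // pchar_Fp_0.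
have [x nz_x xe1] : exists2 x : 'F_p, x != 0 & x ^+ e.+1 != 1.
  apply/exists_inP; apply: contraLR lt_e => /exists_inPn all1; rewrite -leqNgt.
  have := @max_poly_roots 'F_p ('X^(e.+1) - 1) (enum [pred x : 'F_p | x != 0]).
  rewrite -size_poly_eq0 size_XnsubC // => /(_ isT).
  have -> : all (root ('X^(e.+1) - 1)) (enum [pred x : 'F_p | x != 0]).
    apply/allP => x; rewrite mem_enum => /all1; rewrite negbK => /eqP xe.
    by rewrite rootE !hornerE xe subrr.
  rewrite enum_uniq -cardE => /(_ isT isT).
  by rewrite (eq_card (B := predC1 0)) // cardC1 card_Fp.
pose S := \sum_(x : 'F_p) x ^+ e.+1.
have eqS : S = x ^+ e.+1 * S.
  rewrite {1}/S (reindex_inj (mulfI nz_x)) /= mulr_sumr.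
  by apply: eq_bigr => y _; rewrite exprMn.
apply/eqP; move/eqP: eqS; rewrite eq_sym -subr_eq0 -{2}[S]mul1r -mulrBl mulf_eq0.
by rewrite subr_eq0 (negPf xe1).
Qed.

(* Expanding the product gives monomials of degree [#|J|] in [k] variables, so
   some variable occurs with an exponent smaller than [p.-1]. *)
Lemma sum_prod_linear_forms p k (J : finType) (L : J -> 'I_k -> 'F_p) :
  prime p -> (#|J| < k * p.-1)%N ->
  \sum_(t : {ffun 'I_k -> 'F_p}) \prod_(j : J) \sum_i t i * L j i = 0.
Proof.
move=> p_pr ltJ.
under eq_bigr => t _ do rewrite bigA_distr_bigA.
rewrite exchange_big big1 //= => f _.
pose e i := #|[pred j | f j == i]|.
have monE (t : {ffun 'I_k -> 'F_p}) :
    \prod_j (t (f j) * L j (f j)) = (\prod_i t i ^+ e i) * \prod_j L j (f j).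
  rewrite big_split /=; congr (_ * _).
  rewrite (partition_big f xpredT) //=; apply: eq_bigr => i _.
  by rewrite -prodr_const; apply: eq_big => // j /eqP->.
under eq_bigr => t _ do rewrite monE.
rewrite -mulr_suml -(bigA_distr_bigA (fun i x => x ^+ e i)).
have [i lt_ei] : exists i, (e i < p.-1)%N.
  apply/existsP; apply: contraLR ltJ; rewrite negb_exists => /forallP ge_e.
  have -> : #|J| = (\sum_i e i)%N.
    rewrite -sum1_card (partition_big f xpredT) //=.
    by apply: eq_bigr => i _; rewrite sum1_card.
  rewrite -leqNgt -{1}[k]card_ord -sum_nat_const leq_sum // => i _.
  by rewrite leqNgt ge_e.
by rewrite (bigD1 i) //= sum_expr_Fp ?mul0r ?mul0r.
Qed.

(** The zero diagonal is a separate condition because in characteristic two it does not follow from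
    skew symmetry. *)
Definition alternating_mx (R : pzRingType) n (A : 'M[R]_n) :=
  (A^T == - A) && [forall i, A i i == 0].

Lemma alternating_mxP (R : pzRingType) n (A : 'M[R]_n) :
  reflect ((forall i j, A j i = - A i j) /\ forall i, A i i = 0)
    (alternating_mx A).
Proof.
apply: (iffP andP) => [[/eqP AT /forallP A0] | [AT A0]].
  by split=> [i j | i]; [move/matrixP/(_ i j): AT; rewrite !mxE | apply/eqP].
split; last by apply/forallP => i; rewrite A0.
by apply/eqP/matrixP => i j; rewrite !mxE.
Qed.

(** The diagonal is the delicate part: writing [A = U - U^T] makes it a difference of two equal
    diagonals, with no division by two. *)
Lemma alternating_mx_congr (R : comPzRingType) n m (A : 'M[R]_n) (P : 'M_(m, n)) :
  alternating_mx A -> alternating_mx (P *m A *m P^T).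
Proof.
move=> /alternating_mxP[AT A0].
have AN : A^T = - A by apply/matrixP => i j; rewrite !mxE.
apply/andP; split; first by rewrite !trmx_mul trmxK AN mulNmx mulmxN mulmxA.
apply/forallP => i; apply/eqP.
pose U := \matrix_(i, j) if (i < j)%N then A i j else 0.
have -> : A = U - U^T.
  apply/matrixP => a b; rewrite !mxE; case: ltngtP => [_|_|/val_inj->].
  - by rewrite subr0.
  - by rewrite sub0r -AT.
  - by rewrite subr0 A0.
rewrite mulmxBr mulmxBl.
have -> : P *m U^T *m P^T = (P *m U *m P^T)^T by rewrite !trmx_mul trmxK mulmxA.
by rewrite !mxE subrr.
Qed.

Lemma det_mx_2x2 (R : comPzRingType) (A : 'M[R]_2) :
  \det A = A 0 0 * A 1 1 - A 0 1 * A 1 0.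
Proof.
rewrite (expand_det_row A 0) !big_ord_recl big_ord0 addr0.
rewrite /cofactor !det_mx11 !mxE /= expr0 expr1 mul1r mulN1r mulrN.
by congr (A _ _ * A _ _ - A _ _ * A _ _); apply/val_inj.
Qed.

(* Schur complement with respect to an invertible 2 x 2 principal block. *)
Lemma det_alternating_sqr (F : fieldType) n (A : 'M[F]_n) :
  alternating_mx A -> \det A != 0 -> exists s, \det A = s ^+ 2.
Proof.
elim/ltn_ind: n => [[|[|n]]] IHn in A *.
- by exists 1; rewrite det_mx00 expr1n.
- by move=> /alternating_mxP[_ A0]; rewrite det_mx11 A0 eqxx.
wlog A01 : A / A 0 1 != 0 => [IHA altA nzA | altA nzA].
  have /alternating_mxP[AN A0] := altA.
  have [j A0j] : exists j, A 0 j != 0.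
    apply/existsP; apply: contraNT nzA => /existsPn z.
    rewrite (expand_det_row A 0) big1 // => j _.
    by have := z j; rewrite negbK => /eqP->; rewrite mul0r.
  have nzj : j != 0 by apply: contraNneq A0j => ->; rewrite A0.
  (* The same transposition acts on rows and columns, so the two signs cancel and the matrix stays
     alternating. *)
  pose s := tperm 1 j; pose A1 := col_perm s (row_perm s A).
  have detA1 : \det A1 = \det A.
    rewrite /A1 col_permE row_permE !det_mulmx !det_perm mulrAC.
    by rewrite -signr_addb odd_permV addbb mul1r.
  rewrite -detA1; apply: IHA; last by rewrite detA1.
    by rewrite !mxE tpermL tpermD // eq_sym.
  by apply/alternating_mxP; split=> [a b | a]; rewrite !mxE.
have /alternating_mxP[AN A0] := altA.
pose S := @ulsubmx _ 2 n 2 n A; pose B := @ursubmx _ 2 n 2 n A.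
pose D := @drsubmx _ 2 n 2 n A; set s := A 0 1 in A01.
have SE : S = \matrix_(i, j) (if i == j then 0 else if i == 0 then s else - s).
  apply/matrixP => i j; rewrite !mxE.
  case: (unliftP 0 i) => [i'|] ->; case: (unliftP 0 j) => [j'|] -> /=; rewrite ?ord1.
  - by rewrite A0.
  - by rewrite AN; congr (- A _ _); apply/val_inj.
  - by congr (A _ _); apply/val_inj.
  - by rewrite A0.
have SS : S *m S = - (s ^+ 2)%:M.
  apply/matrixP => i j; rewrite !mxE !big_ord_recl big_ord0 addr0 SE !mxE.
  case: (unliftP 0 i) => [i'|] ->; case: (unliftP 0 j) => [j'|] -> /=; rewrite ?ord1 /=.
  - by rewrite mul0r addr0 mulNr.
  - by rewrite mulr0 mul0r addr0 oppr0.
  - by rewrite mulr0 mul0r addr0 oppr0.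
  - by rewrite mul0r add0r mulrN.
have AE : A = block_mx S B (- B^T) D.
  have <- : @dlsubmx _ 2 n 2 n A = - B^T.
    by apply/matrixP => i j; rewrite !mxE AN.
  by rewrite (@submxK _ 2 n 2 n).
(* As [S *m S] is the scalar [- s ^+ 2], this is [B^T] times the inverse of [S]; it clears the lower
   left block and leaves the Schur complement [D']. *)
pose X := - (s ^- 2) *: (B^T *m S).
pose D' := D + X *m B.
have detL : \det (block_mx 1%:M 0 X 1%:M) = 1 by rewrite det_lblock !det1 mulr1.
have detA : \det A = s ^+ 2 * \det D'.
  rewrite -[LHS]mul1r -detL AE -det_mulmx mulmx_block !mul1mx !mul0mx !addr0.
  rewrite -scalemxAl -mulmxA SS mulmxN scalerN -scaleNr opprK -scalemx1.
  rewrite -scalemxAr mulmx1 scalerA mulVf ?expf_neq0 // scale1r subrr.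
  rewrite [X *m B + D]addrC det_ublock; congr (_ * _).
  by rewrite det_mx_2x2 SE !mxE /= mul0r sub0r mulrN opprK expr2.
have altD' : alternating_mx D'.
  have := alternating_mx_congr B^T (A := S).
  rewrite trmxK => /(_ _)/alternating_mxP[|BN B0].
    by apply/alternating_mxP; split=> [a b|a]; rewrite !mxE.
  have DE a b : D' a b = D a b - s ^- 2 * (B^T *m S *m B) a b.
    by rewrite /D' -scalemxAl mxE [X in _ + X]mxE mulNr.
  apply/alternating_mxP; split=> [a b|a]; rewrite !DE.
    by rewrite BN !mxE AN mulrN opprB opprK addrC.
  by rewrite B0 mulr0 subr0 !mxE A0.
have nzD' : \det D' != 0 by apply: contraNneq nzA => z; rewrite detA z mulr0.
have [|r detD'] := IHn n _ D' altD' nzD'; first by rewrite leqW.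
by exists (s * r); rewrite detA detD' exprMn.
Qed.

(** Points moved by [i] pair off with equal values, and each pair sums to zero; [enum_rank] selects
    one point of each pair. *)
Lemma sum_involution_char2 (R : pzRingType) (T : finType) (i : T -> T) (F : T -> R) :
  2%N%:R = 0 :> R -> involutive i -> (forall x, F (i x) = F x) ->
  \sum_x F x = \sum_(x | i x == x) F x.
Proof.
move=> R2 iK Fi; rewrite (bigID (fun x => i x == x)) /= -[RHS]addr0; congr (_ + _).
rewrite (bigID (fun x => enum_rank x < enum_rank (i x))%N) /=.
rewrite [X in _ + X](reindex_inj (inv_inj iK)) /=.
under [X in _ + X]eq_bigl => x do rewrite iK.
rewrite [X in _ + X](eq_bigl (fun x => (i x != x) && (enum_rank x < enum_rank (i x))%N)).
  under [X in _ + X]eq_bigr => x _ do rewrite Fi.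
  by rewrite -mulr2n -mulr_natr R2 mulr0.
move=> x; rewrite eq_sym; case: eqP => //= /eqP ix; rewrite -leqNgt leq_eqVlt.
by rewrite (inj_eq val_inj) (inj_eq enum_rank_inj) eq_sym (negPf ix).
Qed.

(* This is the square of the Pfaffian in characteristic two, where squaring is
   the identity of ['F_2]. *)
Lemma det_alternating_F2 r (A : 'M['F_2]_r) : alternating_mx A ->
  \det A = \sum_(s : 'S_r | (s^-1%g == s) && [forall a, s a != a])
             \prod_(a : 'I_r | (a < s a)%N) A a (s a).
Proof.
move=> /alternating_mxP[AN A0].
have F2 : 2%N%:R = 0 :> 'F_2 by apply/eqP.
have oppF2 (x : 'F_2) : - x = x.
  by apply/eqP; rewrite -subr_eq0 -opprD -mulr2n -mulr_natr F2 mulr0 oppr0.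
have sqF2 (x : 'F_2) : x * x = x by rewrite -expr2 -[in RHS](expf_card x) card_Fp.
have As a b : A a b = A b a by rewrite AN oppF2.
rewrite /determinant (sum_involution_char2 (i := fun s : 'S_r => s^-1%g)) //; first last.
- move=> s; rewrite odd_permV; congr (_ * _).
  rewrite (reindex_inj (@perm_inj _ s)) /=.
  by apply: eq_bigr => a _; rewrite permK As.
- exact: invgK.
(* A fixed point contributes a zero diagonal entry. Without fixed points, each transposition
   contributes the same entry twice, and [x * x = x] in ['F_2]. *)
rewrite (bigID (fun s : 'S_r => [forall a, s a != a])) /= addrC big1 ?add0r.
  apply: eq_bigr => s /andP[/eqP sV /forallP s_fpf].
  have -> : (-1) ^+ s = 1 :> 'F_2 by rewrite -signr_odd; case: odd; rewrite ?expr1 ?oppF2.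
  have sK a : s (s a) = a by rewrite -{1}sV permK.
  rewrite mul1r (bigID (fun a : 'I_r => a < s a)%N) /=.
  rewrite [X in _ * X](reindex_inj (@perm_inj _ s)) /=.
  rewrite [X in _ * X](eq_big (fun a : 'I_r => a < s a)%N (fun a => A a (s a))).
  - by rewrite sqF2.
  - move=> a; rewrite sK -leqNgt leq_eqVlt (inj_eq val_inj) eq_sym.
    by rewrite (negPf (s_fpf a)).
  - by move=> a _; rewrite sK As.
move=> s /andP[_]; rewrite negb_forall => /existsP[a]; rewrite negbK => /eqP sa.
by rewrite (bigD1 a) //= sa A0 mul0r mulr0.
Qed.

(** The involution exchanges the points with [a < s a] and those with [s a < a]. *)
Lemma card_fpf_involution r (s : 'S_r) :
  s^-1%g == s -> (forall a, s a != a) -> #|[pred a : 'I_r | (a < s a)%N]|.*2 = r.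
Proof.
move=> /eqP sV s_fpf; have sK a : s (s a) = a by rewrite -{1}sV permK.
rewrite -[RHS]card_ord -(cardC [pred a : 'I_r | (a < s a)%N]) -addnn; congr (_ + _)%N.
rewrite -(card_image (@perm_inj _ s)); apply: eq_card => a.
rewrite !inE -leqNgt leq_eqVlt (inj_eq val_inj) (negPf (s_fpf a)) /=.
apply/imageP/idP => [[b] | lta]; first by rewrite inE => ltb ->; rewrite sK.
by exists (s a); rewrite ?inE sK.
Qed.

(* The power [det^((p-1)/2)] for odd [p], and the Pfaffian for [p = 2], is a
   polynomial in [t] of degree at most [(p-1) r/2] that is [1] away from
   [t = 0] and [0] at [t = 0]. As in the Chevalley-Warning theorem this is
   impossible when [r/2 < k]. *)
Lemma nondegenerate_alternating_space p k r (L : 'I_r -> 'I_r -> 'I_k -> 'F_p)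
    (A : {ffun 'I_k -> 'F_p} -> 'M['F_p]_r) :
  prime p -> (0 < r)%N ->
  (forall t a b, A t a b = \sum_i t i * L a b i) ->
  (forall t, alternating_mx (A t)) ->
  (forall t, t != 0 -> \det (A t) != 0) ->
  (k.*2 <= r)%N.
Proof.
move=> p_pr r_gt0 AE altA nzA; rewrite leqNgt; apply/negP => lt_rk.
have k_gt0 : (0 < k)%N by case: k lt_rk {L A AE altA nzA}.
(* Such a sum counts the [p ^ k - 1] nonzero vectors, which is [-1] in ['F_p] since [k > 0]. *)
have sumN0 (f : {ffun 'I_k -> 'F_p} -> 'F_p) :
  f 0 = 0 -> (forall t, t != 0 -> f t = 1) -> \sum_t f t <> 0.
  move=> f0 f1; rewrite (bigD1 (0 : {ffun 'I_k -> 'F_p})) //= f0 add0r.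
  rewrite (eq_bigr (fun=> 1)) // sumr_const.
  rewrite (_ : #|_| = (p ^ k).-1); last first.
    rewrite -[in RHS](card_Fp p_pr) -[k in RHS]card_ord -card_ffun.
    by rewrite -(cardC1 (0 : {ffun 'I_k -> 'F_p})); apply: eq_card.
  apply/eqP; rewrite -subn1 mulrnBr ?expn_gt0 ?prime_gt0 // natrX pchar_Fp_0 //.
  by rewrite expr0n gtn_eqF // sub0r mulr1n oppr_eq0 oner_eq0.
have A0 : \det (A 0) = 0.
  have -> : A 0 = 0.
    by apply/matrixP => a b; rewrite AE mxE big1 // => i _; rewrite ffunE mul0r.
  by case: r r_gt0 {L A AE altA nzA lt_rk} => // r _; rewrite det0.
have Fp1 (x : 'F_p) : x != 0 -> x ^+ p.-1 = 1.
  move=> nzx; apply: (mulfI nzx); rewrite -exprS prednK ?prime_gt0 // mulr1.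
  by have := expf_card x; rewrite card_Fp.
have [p2 | p_odd] := even_prime p_pr.
  subst p; apply: (sumN0 (fun t => \det (A t))) => // [u nzu|].
    by rewrite -[LHS]expr1 Fp1 ?nzA.
  under eq_bigr => u _ do rewrite det_alternating_F2 //.
  rewrite exchange_big big1 //= => s /andP[sV /forallP s_fpf].
  pose J := [pred a : 'I_r | (a < s a)%N].
  have prodE (u : {ffun 'I_k -> 'F_2}) : \prod_(a : 'I_r | (a < s a)%N) A u a (s a)
      = \prod_(l < #|J|) \sum_i u i * L (enum_val l) (s (enum_val l)) i.
    rewrite -(big_enum_val (fun a => \sum_i u i * L a (s a) i)) /=.
    by apply: eq_big => // a _; rewrite AE.
  under eq_bigr => u _ do rewrite prodE.
  apply: sum_prod_linear_forms => //; rewrite card_ord muln1.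
  by rewrite -ltn_double card_fpf_involution.
(* A nonzero determinant is a square [s ^+ 2], so its [h]-th power is [s ^+ p.-1 = 1]. *)
pose h := p.-1./2.
have hE : p.-1 = h.*2.
  by rewrite -[LHS]odd_double_half -{1}subn1 oddB ?prime_gt0 // p_odd add0n.
have h_gt0 : (0 < h)%N by rewrite -double_gt0 -hE -subn1 subn_gt0 prime_gt1.
apply: (sumN0 (fun t => \det (A t) ^+ h)) => [|u nzu|]; first by rewrite A0 expr0n gtn_eqF.
  have [s detE] := det_alternating_sqr (altA u) (nzA _ nzu).
  rewrite detE -exprM mul2n -hE Fp1 //.
  by apply: contraNneq (nzA _ nzu) => s0; rewrite detE s0 expr0n.
(* Choosing one permutation for each of the [h] factors gives products of [h * r] linear forms, and
   [h * r < k * p.-1] because [r < k.*2]. *)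
have detE (u : {ffun 'I_k -> 'F_p}) : \det (A u) ^+ h =
  \sum_(f : {ffun 'I_h -> 'S_r}) (\prod_l (-1) ^+ f l) *
     \prod_(j : 'I_h * 'I_r) \sum_i u i * L j.2 (f j.1 j.2) i.
  rewrite -[h in LHS]card_ord -prodr_const bigA_distr_bigA; apply: eq_bigr => f _.
  rewrite big_split pair_bigA; congr (_ * _).
  by apply: eq_bigr => j _; rewrite AE.
under eq_bigr => u _ do rewrite detE.
rewrite exchange_big big1 //= => f _; rewrite -mulr_sumr.
rewrite (sum_prod_linear_forms (fun j : 'I_h * 'I_r => L j.2 (f j.1 j.2))) ?mulr0 //.
by rewrite card_prod !card_ord hE -doubleMr doubleMl mulnC ltn_pmul2r.
Qed.

(** Over a prime field every scalar is a multiple of [1], so additivity already implies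
    linearity. *)
Lemma additive_Fp_rowE p r (f : 'rV['F_p]_r -> 'F_p) (c : 'rV_r) :
  {morph f : u v / u + v} -> f c = \sum_a c 0 a * f 'e_a.
Proof.
move=> fD; have f0 : f 0 = 0 by apply: (addrI (f 0)); rewrite -fD !addr0.
have fMn u n : f (u *+ n) = f u *+ n.
  by elim: n => [|n IHn]; rewrite ?mulr0n // !mulrS fD IHn.
rewrite {1}[c]row_sum_delta (big_morph f fD f0); apply: eq_bigr => a _.
by rewrite -[c 0 a]natr_Zp scaler_nat fMn mulr_natl.
Qed.

(** * Commutators in p-groups of class two *)

Local Close Scope ring_scope.
Local Open Scope group_scope.

Section ClassTwo.

Variables (gT : finGroupType) (G : {group gT}).
Hypothesis der_cen : G^`(1) \subset 'Z(G).

Lemma class2_comm_cent x y z :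
  x \in G -> y \in G -> z \in G -> commute z [~ x, y].
Proof.
move=> Gx Gy Gz; apply/commute_sym; have : [~ x, y] \in 'Z(G).
  by apply: (subsetP der_cen); rewrite derg1 mem_commg.
by case/centerP=> _; apply.
Qed.

Lemma class2_commMl x y z : x \in G -> y \in G -> z \in G ->
  [~ x * y, z] = [~ x, z] * [~ y, z].
Proof.
move=> Gx Gy Gz; rewrite commMgJ; congr (_ * _).
by rewrite /conjg -(class2_comm_cent Gx Gz Gy) mulKg.
Qed.

Lemma class2_commXl x y n : x \in G -> y \in G -> [~ x ^+ n, y] = [~ x, y] ^+ n.
Proof. by move=> Gx Gy; apply: commXg; apply: class2_comm_cent. Qed.

Lemma class2_commXr x y n : x \in G -> y \in G -> [~ x, y ^+ n] = [~ x, y] ^+ n.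
Proof. by move=> Gx Gy; apply: commgX; apply: class2_comm_cent. Qed.

Lemma comm_cent1 z y : z \in 'Z(G) -> y \in G -> [~ z, y] = 1.
Proof. by case/centerP=> _ cz Gy; apply/eqP/commgP/cz. Qed.

(** This makes the forms built from commutators independent of the representatives chosen modulo the
    center. *)
Lemma class2_comm_coset x x' y : x \in G -> x' \in G -> y \in G ->
  coset 'Z(G) x = coset 'Z(G) x' -> [~ x, y] = [~ x', y].
Proof.
have nZ z : z \in G -> z \in 'N('Z(G)) by apply: subsetP; apply: normal_norm (center_normal G).
move=> Gx Gx' Gy eqx; have Zxx' : x^-1 * x' \in 'Z(G).
  apply: coset_idr; first by rewrite groupM ?groupV ?nZ.
  by rewrite morphM ?groupV ?nZ // morphV ?nZ //= eqx mulVg.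
by rewrite -[x'](mulKVg x) class2_commMl ?groupM ?groupV // (comm_cent1 Zxx') ?mulg1.
Qed.

End ClassTwo.

(* The hypothesis on [T] makes every linear functional on [M], extended to [W],
   induce a nondegenerate alternating form on [V]. *)
Lemma class2_der_bound (gT : finGroupType) (p : nat) (G M : {group gT}) :
  prime p -> p.-group G -> G^`(1) \subset 'Z(G) -> M \subset G^`(1) ->
  (forall (T : {group gT}) x, T \subset G^`(1) -> ~~ (M \subset T) -> x \in G ->
     (forall g, g \in G -> [~ x, g] \in T) -> x \in 'Z(G)) ->
  #|M| ^ 2 <= #|G : 'Z(G)|.
Proof.
move=> p_pr pG der_cen sMG' star.
have [-> | ntM] := eqVneq (M : {set gT}) 1; first by rewrite cards1 exp1n ?indexg_gt0.
have nZG := normal_norm (center_normal G).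
have nZ z : z \in G -> z \in 'N('Z(G)) by apply: subsetP.
have cosX x n : x \in G -> coset 'Z(G) (x ^+ n) = coset 'Z(G) x ^+ n.
  by move=> Gx; rewrite morphX ?nZ.
pose W := 'Ohm_1(G^`(1))%G.
have pG' : p.-group G^`(1) by apply: pgroupS (der_sub 1 G) pG.
have abG' : abelian G^`(1) by apply: abelianS der_cen (center_abelian G).
have abelW : p.-abelem W by apply: Ohm1_abelem.
have memW x y : x \in G -> y \in G -> [~ x, y] ^+ p = 1 -> [~ x, y] \in W.
  move=> Gx Gy xyp; have -> : (W : {set gT}) = 'Ldiv_p(G^`(1)).
    by rewrite -[p in 'Ldiv_p(_)]expn1 -OhmEabelian ?(abelianS (Ohm_sub _ _)).
  by apply/LdivP; split=> //; rewrite derg1 mem_commg.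
have sWG' : W \subset G^`(1) by apply: Ohm_sub.
pose U := G / 'Z(G); have pU : p.-group U by apply: quotient_pgroup.
have abU : abelian U by apply: sub_der1_abelian.
have ntU : U != 1.
  apply: contraNneq ntM => U1; rewrite -subG1; apply: subset_trans sMG' _.
  apply/trivgP/derG1P; apply: abelianS (center_abelian G).
  by rewrite -quotient_sub1 // -/U U1.
(* If [x] has order [p] modulo the center, then [[x, g]^p = [x^p, g] = 1], so all [[x, g]] lie in
   [W]. Were [M] not inside [W], [star] with [T = W] would make [x] central. *)
have sMW : M \subset W.
  have [u Uu ou] : {u | u \in U & #[u] = p}.
    by apply: Cauchy => //; case: (pgroup_pdiv pU ntU).
  apply: contraT => not_sMW.
  have [x nZx Gx uE] := morphimP Uu.
  have Zx : x \in 'Z(G).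
    apply: star not_sMW _ _ => // g Gg; apply: memW => //.
    rewrite -(class2_commXl der_cen) //; apply: (comm_cent1 (G := G)) => //.
    by apply: coset_idr; rewrite ?groupX // cosX // -uE -ou expg_order.
  by have := prime_gt1 p_pr; rewrite -ou uE /= coset_id // order1.
have [e expU] : {e | exponent U = (p ^ e)%N} by apply/p_natP; rewrite pnat_exponent.
have e_gt0 : 0 < e.
  by rewrite lt0n; apply: contraNneq ntU => e0; rewrite trivg_exponent expU e0.
pose q := (p ^ e.-1)%N; have qp : (q * p)%N = (p ^ e)%N by rewrite -expnSr prednK.
(* [V = U^q] is the elementary abelian group carrying the forms: for [u, v] in
   [U], the class of [[u, v]^q = [u^q, v] = [u, v^q]] depends only on [u^q] and
   [v^q]. Passing to [V] is what allows [U] to have exponent larger than [p]. *)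
pose V := 'Mho^(e.-1)(U)%G.
have memV v : reflect (exists2 x, x \in G & v = coset 'Z(G) x ^+ q) (v \in V).
  rewrite /= (MhoEabelian _ pU) //; apply: (iffP imsetP) => [[u Uu ->] | [x Gx ->]].
    by have [x nZx Gx ->] := morphimP Uu; exists x.
  by exists (coset 'Z(G) x); rewrite ?mem_quotient.
have xpe x : x \in G -> coset 'Z(G) x ^+ (p ^ e) = 1.
  by move=> Gx; rewrite -expU expg_exponent ?mem_quotient.
have ntV : V != 1 :> {set _}.
  apply: contraTneq (prime_gt1 p_pr) => V1.
  have : exponent U %| q.
    apply/exponentP => u /morphimP[x _ Gx ->] /=.
    have : coset 'Z(G) x ^+ q \in V by apply/memV; exists x.
    by rewrite V1 => /set1P.
  by rewrite expU -qp -{2}[q]muln1 dvdn_pmul2l ?expn_gt0 ?prime_gt0 // dvdn1 => /eqP->.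
have abelV : p.-abelem V.
  rewrite abelemE // (abelianS (Mho_sub _ _) abU); apply/exponentP => v /memV[x Gx ->].
  by rewrite -expgM qp xpe.
have ntW : W != 1 :> {set _} by apply: contraNneq ntM => W1; rewrite -subG1 -W1.
pose r := 'dim V; pose rV := rVabelem abelV ntV; pose rW := abelem_rV abelW ntW.
(* [Y c] is an element of [G] whose [q]-th power represents the vector [c] of [V]. *)
have [Y /all_and2[GY YE]] : exists Y : 'rV['F_p]_r -> gT,
    forall c, Y c \in G /\ coset 'Z(G) (Y c) ^+ q = rV c.
  apply: (@fin_all_exists _ _ (fun c y => y \in G /\ coset 'Z(G) y ^+ q = rV c)) => c.
  by have /memV[x Gx xE] := mem_rVabelem abelV ntV c; exists x.
(* [w |-> rW w *m P] projects [W] onto [M], both viewed as row spaces. *)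
pose R0 := rowg_mx (rW @* M); pose R := row_base R0; pose P := pinvmx R.
have cardM : #|M| = (p ^ \rank R0)%N.
  by have := card_rowg R0; rewrite card_Fp // rowg_mxK card_injm ?abelem_rV_injm.
have cardV : #|V| = (p ^ r)%N.
  by rewrite -(card_abelem_rV abelV ntV) card_mx card_Fp // mul1n.
pose w c d := [~ Y c, Y d] ^+ q.
have memw x y : x \in G -> y \in G -> [~ x, y] ^+ q \in W.
  move=> Gx Gy; rewrite -(class2_commXl der_cen) //; apply: memW; rewrite ?groupX //.
  rewrite -(class2_commXl der_cen) ?groupX // -expgM qp; apply: (comm_cent1 (G := G)) => //.
  by apply: coset_idr; rewrite ?nZ ?groupX // cosX ?xpe.
have wDl c c' d : w (c + c')%R d = w c d * w c' d.
  rewrite /w -!(class2_commXl der_cen) ?GY // -(class2_commMl der_cen) ?groupX ?GY //.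
  apply: (class2_comm_coset der_cen); rewrite ?groupM ?groupX ?GY //.
  by rewrite morphM ?nZ ?groupX ?GY //= !cosX ?GY // !YE /rV rVabelemD.
have wC c d : w d c = (w c d)^-1 by rewrite /w -expgVn invgR.
have memwW c d : w c d \in W by apply: memw.
pose L a b i := (rW (w 'e_a 'e_b) *m P)%R 0%R i.
(* The linear functional on [W] taking the value [t i] on the [i]-th basis row [R] of [M]. *)
pose phi (t : {ffun 'I_(\rank R0) -> 'F_p}) z := (\sum_i t i * (rW z *m P) 0 i)%R.
have phiD t : {in W &, {morph phi t : x y / x * y >-> (x + y)%R}}.
  move=> x y Wx Wy; rewrite /phi /rW abelem_rV_M // mulmxDl -big_split /=.
  by apply: eq_bigr => i _; rewrite mxE mulrDr.
have phi1 t : phi t 1 = 0%R by apply: (addrI (phi t 1)); rewrite -phiD // mulg1 addr0.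
have phiV t x : x \in W -> phi t x^-1 = (- phi t x)%R.
  by move=> Wx; apply: (addrI (phi t x)); rewrite -phiD ?groupV // mulgV phi1 subrr.
have phiW t c d : phi t (w c d) = (- phi t (w d c))%R by rewrite wC phiV.
pose A t := (\matrix_(a < r, b < r) phi t (w 'e_a 'e_b))%R.
have phiE t c d : phi t (w c d) = (c *m A t *m d^T)%R 0%R 0%R.
  have addl d' : {morph (fun c' => phi t (w c' d')) : u v / (u + v)%R}.
    by move=> u v; rewrite wDl phiD.
  have addr c' : {morph (fun d' => phi t (w c' d')) : u v / (u + v)%R}.
    by move=> u v; rewrite (phiW t c') (phiW t c' u) (phiW t c' v) wDl phiD // opprD.
  rewrite (additive_Fp_rowE d (addr c)) mxE; apply: eq_bigr => b _.
  rewrite (additive_Fp_rowE c (addl (delta_mx 0%R b))) mulrC !mxE; congr (_ * _)%R.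
  by apply: eq_bigr => a _; rewrite mxE.
have bound : (\rank R0).*2 <= r.
  apply: (@nondegenerate_alternating_space p _ r L A) => //.
  - by move=> t a b; rewrite mxE.
  - move=> t; apply/alternating_mxP; split=> [a b | a]; rewrite !mxE.
      by rewrite wC phiV.
    by rewrite /w commgg expg1n phi1.
  move=> t nz_t; apply/det0P => -[c nz_c cA0].
  (* The kernel of [phi t] serves as [T] in [star]: it misses part of [M] as [t != 0], and a null
     vector [c] of the form has all [[Y c ^+ q, h]] in it. Hence [Y c ^+ q] is central, that is,
     [c = 0]. *)
  have gsT : group_set [set z in W | phi t z == 0%R].
    apply/group_setP; split=> [|x y]; first by rewrite inE group1 phi1 eqxx.
    rewrite !inE => /andP[Wx /eqP x0] /andP[Wy /eqP y0].
    by rewrite groupM // phiD // x0 y0 addr0 eqxx.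
  have : Y c ^+ q \in 'Z(G).
    apply: (star (group gsT)) => [|||h Gh].
    - by apply/subsetP => z; rewrite inE => /andP[Wz _]; apply: (subsetP sWG').
    - have [i nz_ti] : exists i, t i != 0%R.
        apply/existsP; apply: contraNT nz_t => /existsPn t0.
        by apply/eqP/ffunP => i; rewrite ffunE; apply/eqP; rewrite -[_ == _]negbK t0.
      have : row i R \in rowg R0 by rewrite mem_rowg -(eq_row_base R0) row_sub.
      rewrite rowg_mxK => /morphimP[m Wm Mm mE].
      apply: contra nz_ti => /subsetP/(_ m Mm); rewrite inE => /andP[_].
      rewrite /phi /rW -mE -row_mul mulmxVp ?row_base_free // (bigD1 i) //=.
      rewrite big1 => [|j nji]; first by rewrite !mxE eqxx mulr1 addr0.
      by rewrite !mxE eq_sym (negPf nji) mulr0.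
    - by rewrite groupX.
    have Vh : coset 'Z(G) h ^+ q \in V by apply/memV; exists h.
    pose d := abelem_rV abelV ntV (coset 'Z(G) h ^+ q).
    have <- : w c d = [~ Y c ^+ q, h].
      rewrite (class2_commXl der_cen) // -(class2_commXr der_cen) // /w.
      rewrite -(class2_commXr der_cen) // -invgR -[RHS]invgR; congr _^-1.
      apply: (class2_comm_coset der_cen); rewrite ?groupX //.
      by rewrite !cosX // YE /rV abelem_rV_K.
    by rewrite inE memwW phiE cA0 mul0mx mxE.
  move/coset_id; rewrite cosX // YE => rc1; case/eqP: nz_c.
  by apply: (rVabelem_inj abelV ntV); rewrite rVabelem0.
rewrite cardM -expnM muln2; apply: (@leq_trans (p ^ r)).
  by rewrite leq_exp2l ?prime_gt1.
by rewrite -cardV -card_quotient // subset_leq_card ?Mho_sub.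
Qed.

(** Apply [class2_der_bound] to [M / N] in [G / N], pulling each [T] back to [G]. Since [X / N] is
    central there, the index of the center of [G / N] is at most [#|G : X|]. *)
Lemma class2_comm_index_bound (gT : finGroupType) (p : nat) (G X M N : {group gT}) :
  prime p -> p.-group G -> G^`(1) \subset 'Z(G) ->
  X \subset G -> [~: X, G] \subset N -> N \subset M -> M \subset G^`(1) ->
  (forall (T : {group gT}) x, N \subset T -> T \subset G^`(1) -> ~~ (M \subset T) ->
     x \in G -> (forall g, g \in G -> [~ x, g] \in T) -> x \in X) ->
  #|M : N| ^ 2 <= #|G : X|.
Proof.
move=> p_pr pG der_cen sXG sXGN sNM sMG' star.
have sNZ : N \subset 'Z(G) := subset_trans sNM (subset_trans sMG' der_cen).
have nsNG : N <| G := sub_center_normal sNZ; have nNG := normal_norm nsNG.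
have sMG : M \subset G := subset_trans sMG' (der_sub 1 G).
have cXG : X / N \subset 'Z(G / N).
  by rewrite subsetI quotientS // quotient_cents2 // (subset_trans sXG).
apply: (@leq_trans #|G / N : 'Z(G / N)|); last first.
  apply: (@leq_trans #|G / N : X / N|).
    by rewrite -(Lagrange_index (center_sub _) cXG) leq_pmulr ?indexg_gt0.
  by apply: dvdn_leq; rewrite ?indexg_gt0 // index_morphim // subIset ?nNG.
rewrite -card_quotient ?(subset_trans sMG) //.
have derE : (G / N)^`(1) = G^`(1) / N by rewrite quotient_der.
apply: (@class2_der_bound _ p _ (M / N)%G) => //.
- exact: quotient_pgroup.
- rewrite derE; apply: subset_trans (quotientS N der_cen) _.
  by rewrite subsetI quotientS ?center_sub ?quotient_cents ?subsetIr.
- by rewrite derE quotientS.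
move=> T xb; rewrite derE => sTG' nsMT /morphimP[x nNx Gx ->] cT.
apply: (subsetP cXG); apply: mem_quotient.
have nNM : M \subset 'N(N) := subset_trans sMG nNG.
apply: (star (coset N @*^-1 T)%G) => //.
- exact: sub_cosetpre.
- by rewrite sub_cosetpre_quo // (normalS _ (der_sub 1 G)) // (subset_trans sNM).
- by rewrite -sub_quotient_pre.
- move=> g Gg; have nNg := subsetP nNG _ Gg.
  apply/morphpreP; split; first exact: groupR.
  by rewrite morphR //= cT ?mem_quotient.
Qed.

(** * Centers of irreducible characters and their chain *)

Lemma cfcenter_irrP (gT : finGroupType) (G : {group gT}) (i : Iirr G) x :
  reflect (x \in G /\ forall g, g \in G -> [~ x, g] \in cfker ('chi_i)%R)
          (x \in 'Z(('chi_i)%R)%CF).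
Proof.
have nKG := normal_norm (cfker_normal ('chi_i)%R).
have sZG := cfcenter_sub ('chi_i)%R.
apply: (iffP idP) => [Zx | [Gx cx]].
  have Gx := subsetP sZG _ Zx; split=> // g Gg.
  (* The center of an irreducible character is the preimage of the center of [G] modulo its
     kernel. *)
  have: coset (cfker ('chi_i)%R) x \in 'Z(G / cfker ('chi_i)%R).
    by rewrite -cfcenter_eq_center mem_quotient.
  case/centerP=> _ /(_ (coset _ g) (mem_quotient _ Gg)) cxg.
  have [nx ng] := (subsetP nKG _ Gx, subsetP nKG _ Gg).
  apply: coset_idr; first exact: groupR.
  by rewrite morphR //; apply/eqP/commgP.
have: coset (cfker ('chi_i)%R) x \in 'Z(('chi_i)%R)%CF / cfker ('chi_i)%R.
  rewrite cfcenter_eq_center; apply/centerP; split; first exact: mem_quotient.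
  move=> _ /morphimP[g ng Gg ->]; apply/commgP.
  by rewrite -morphR ?(subsetP nKG) //= coset_id ?cx.
move=> xb; rewrite -(quotientGK (cfker_center_normal ('chi_i)%R)).
by apply/morphpreP; rewrite (subsetP nKG).
Qed.

Lemma chain_of_centers_cfcenter (gT : finGroupType) (G : {group gT}) (n : nat)
    (X : nat -> {group gT}) (j : Iirr G) :
  chain_of_centers G n X -> exists2 l, l <= n & 'Z(('chi_j)%R)%CF = X l.
Proof.
case=> _ _ XE; have: 'Z(('chi_j)%R)%CF \in char_centers G by apply/imsetP; exists j.
by rewrite -XE => /imsetP[l _ ->]; exists l; rewrite // -ltnS.
Qed.

Lemma chain_of_centers_sub (gT : finGroupType) (G : {group gT}) (n : nat)
    (X : nat -> {group gT}) (i j : nat) :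
  chain_of_centers G n X -> i <= j <= n -> X j \subset X i.
Proof.
case=> _ ltX _ /andP[le_ij le_jn]; elim: j le_ij le_jn => [|j IHj].
  by rewrite leqn0 => /eqP->.
rewrite leq_eqVlt => /predU1P[-> // | le_ij] lt_jn.
by apply: subset_trans (IHj le_ij (ltnW lt_jn)); apply/proper_sub/ltX.
Qed.

(** The centers of all irreducible characters intersect in ['Z(G)], and [X n] is the smallest of
    them. *)
Lemma chain_of_centers_last (gT : finGroupType) (G : {group gT}) (n : nat)
    (X : nat -> {group gT}) :
  chain_of_centers G n X -> X n = 'Z(G) :> {set gT}.
Proof.
move=> chX; rewrite -cap_cfcenter_irr; apply/eqP; rewrite eqEsubset.
apply/andP; split.
  apply/bigcapsP => j _; have [l le_ln ->] := chain_of_centers_cfcenter j chX.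
  by apply: chain_of_centers_sub chX _; rewrite le_ln leqnn.
have [_ _ XE] := chX; have : (X n : {set gT}) \in char_centers G.
  by rewrite -XE; apply/imsetP; exists ord_max.
by case/imsetP=> j _ ->; apply: bigcap_inf.
Qed.

Lemma chain_comm_index (gT : finGroupType) (p : nat) (G : {group gT})
    (n : nat) (X : nat -> {group gT}) (i : nat) :
  prime p -> p.-group G -> chain_of_centers G n X -> G^`(1) \subset X n ->
  0 < i <= n -> #|[~: X i.-1, G] : [~: X i, G]| ^ 2 <= #|G : X i|.
Proof.
move=> p_pr pG chX sG'X /andP[i_gt0 le_in].
have der_cen : G^`(1) \subset 'Z(G) by rewrite -(chain_of_centers_last chX).
have sXG j : j <= n -> X j \subset G.
  by move=> le_jn; have [<- _ _] := chX; apply: chain_of_centers_sub chX _.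
have le_i1n : i.-1 <= n := leq_trans (leq_pred i) le_in.
apply: (class2_comm_index_bound p_pr pG der_cen) => //.
- exact: sXG.
- by rewrite commSg // (chain_of_centers_sub chX) // leq_pred.
- by rewrite derg1 commSg ?sXG.
move=> T x sNT sTG' nsMT Gx cT.
have nsTG : T <| G := sub_center_normal (subset_trans sTG' der_cen).
(* The normal subgroup [T] is the intersection of the kernels of irreducible characters containing
   it. *)
have [j sTj nsMj] : exists2 j, T \subset cfker ('chi[G]_j)%R
                           & ~~ ([~: X i.-1, G] \subset cfker ('chi_j)%R).
  apply/exists_inP; apply: contraR nsMT => /exists_inPn sM.
  rewrite -(cap_cfker_normal nsTG); apply/bigcapsP => j /sM.
  by rewrite negbK.
have [l le_ln Zj] := chain_of_centers_cfcenter j chX.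
(* Otherwise [X i.-1] lies in the center of ['chi_j], so its commutators with [G] lie in the
   kernel. *)
have le_il : i <= l.
  rewrite -(prednK i_gt0) ltnNge; apply: contra nsMj => le_li.
  rewrite gen_subG; apply/subsetP => _ /imset2P[y g Xy Gg ->].
  have: y \in 'Z(('chi_j)%R)%CF.
    rewrite Zj; apply: (subsetP (chain_of_centers_sub chX _)) Xy.
    by rewrite le_li.
  by case/cfcenter_irrP=> _; apply.
have : x \in 'Z(('chi_j)%R)%CF.
  by apply/cfcenter_irrP; split=> // g /cT; apply: subsetP.
by rewrite Zj; apply: subsetP; apply: chain_of_centers_sub chX _; rewrite le_il.
Qed.

Local Close Scope group_scope.
Unset Implicit Arguments. Set Strict Implicit. Set Printing Implicit Defensive.

Theorem mainTheorem16 (gT : finGroupType) (p : nat) (G : {group gT})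
    (n : nat) (X : nat -> {group gT}) :
  prime p -> (p.-group G)%g -> ~~ abelian G -> nested G ->
  chain_of_centers G n X ->
  (G^`(1) \subset X n)%g ->
  (forall i : nat, (0 < i <= n)%N ->
     (((#|[~: X i.-1, G] : [~: X i, G]|)%g)%:R : algC)
       <= sqrtC (((#|G : X i|)%g)%:R))%R /\
  ((((#|G^`(1)|)%g)%:R : algC)
     <= \prod_(1 <= i < n.+1) sqrtC (((#|G : X i|)%g)%:R))%R.
Proof.
move=> p_pr pG _ _ chX sG'X.
have step i : (0 < i <= n)%N ->
    ((#|[~: X i.-1, G] : [~: X i, G]|%g%:R : algC) <= sqrtC #|G : X i|%g%:R)%R.
  move=> lti; rewrite -(@ler_pXn2r _ 2) ?nnegrE ?sqrtC_ge0 ?ler0n // sqrtCK.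
  by rewrite -natrX ler_nat (chain_comm_index p_pr pG chX).
split=> //.
have XnG : [~: X n, G]%g = 1%g.
  apply/commG1P; rewrite (chain_of_centers_last chX); exact: subsetIr.
have telescope m : (m <= n)%N ->
    #|G^`(1)|%g = (#|[~: X m, G]%g| * \prod_(1 <= i < m.+1) #|[~: X i.-1, G] : [~: X i, G]|%g)%N.
  elim: m => [|m IHm] lt_mn.
    by rewrite big_geq // muln1 derg1; have [-> _ _] := chX.
  rewrite IHm ?(ltnW lt_mn) // [in RHS]big_nat_recr //= mulnCA Lagrange 1?mulnC //.
  by rewrite commSg // (chain_of_centers_sub chX) // leqnSn.
rewrite (telescope n (leqnn n)) XnG cards1 mul1n natr_prod.
rewrite big_nat [leRHS]big_nat; apply: ler_prod => i lti.
by rewrite ler0n step.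
Qed.
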